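(* (In ZF, without the Axiom of Choice.) For every group $\Gamma$ there is a graph $G$ such that $\Gamma$ is isomorphic to $\operatorname{Aut}(G)$, the automorphism group of $G$.
   Context: A graph (simple graph) $G$ is a pair $\langle V(G),E(G)\rangle$ where $V(G)$ is any set and $E(G)\subseteq V(G)^2$ is a symmetric, irreflexive relation. An automorphism of $G$ is a bijection of $V(G)$ preserving both edges and non-edges; $\operatorname{Aut}(G)$ is the group of all automorphisms of $G$. The base theory is ZF (no atoms, no Axiom of Choice). *)

(* Defs.v *)
From Stdlib Require Import Utf8.

Record structure : Type := {
  carrier :> Type;
  mem : carrier -> carrier -> Prop
}.

Arguments mem {s} _ _.

Notation "x ∈ y" := (mem x y) (at level 70, no associativity).
Notation "x ∉ y" := (~ mem x y) (at level 70, no associativity).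

(** First-order formulas of the language of set theory, in de Bruijn form.
    They are needed because Separation and Replacement range over formulas
    only: if they ranged over arbitrary predicates on the carrier, a choice
    principle of the ambient logic would yield the Axiom of Choice in every
    structure satisfying them. *)
Inductive formula : Type :=
| FMem (i j : nat)
| FEq (i j : nat)
| FFalse
| FImp (p q : formula)
| FAnd (p q : formula)
| FOr (p q : formula)
| FAll (p : formula)
| FEx (p : formula).

Definition scons {X : Type} (x : X) (r : nat -> X) (n : nat) : X :=
  match n with O => x | S k => r k end.

Fixpoint sat {M : structure} (r : nat -> M) (p : formula) : Prop :=
  match p with
  | FMem i j => r i ∈ r j
  | FEq i j => r i = r j
  | FFalse => False
  | FImp p q => sat r p -> sat r q
  | FAnd p q => sat r p /\ sat r q
  | FOr p q => sat r p \/ sat r q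
  | FAll p => forall x : M, sat (scons x r) p
  | FEx p => exists x : M, sat (scons x r) p
  end.

(** The valuation [r] supplies the parameters of an instance of a schema. *)
Record ZF (M : structure) : Prop := {
  zf_extensionality : forall a b : M, (forall x, x ∈ a <-> x ∈ b) -> a = b;
  zf_foundation : forall a : M, (exists x, x ∈ a) ->
    exists x, x ∈ a /\ ~ (exists y, y ∈ x /\ y ∈ a);
  zf_pairing : forall a b : M, exists c, forall x, x ∈ c <-> x = a \/ x = b;
  zf_union : forall a : M, exists u, forall x,
    x ∈ u <-> exists y, x ∈ y /\ y ∈ a;
  zf_powerset : forall a : M, exists p, forall x,
    x ∈ p <-> forall y, y ∈ x -> y ∈ a;
  zf_infinity : exists w : M,
    (exists e, e ∈ w /\ forall x, x ∉ e) /\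
    (forall x, x ∈ w ->
       exists s, s ∈ w /\ forall y, y ∈ s <-> y ∈ x \/ y = x);
  zf_separation : forall (p : formula) (r : nat -> M) (a : M),
    exists b, forall x, x ∈ b <-> x ∈ a /\ sat (scons x r) p;
  zf_replacement : forall (p : formula) (r : nat -> M) (a : M),
    (forall x y y', x ∈ a -> sat (scons x (scons y r)) p ->
                    sat (scons x (scons y' r)) p -> y = y') ->
    exists b, forall y,
      y ∈ b <-> exists x, x ∈ a /\ sat (scons x (scons y r)) p
}.

(** All notions below are internal to [M]: the quantifiers range over
    elements of [M] only, and functions, relations, groups and graphs are
    themselves elements of [M]. *)

Definition is_upair {M : structure} (c a b : M) : Prop :=
  forall x, x ∈ c <-> x = a \/ x = b.

(** Kuratowski pair: [p] is [{{a}, {a, b}}]. *)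
Definition is_pair {M : structure} (p a b : M) : Prop :=
  exists u v, is_upair u a a /\ is_upair v a b /\ is_upair p u v.

Definition is_prod {M : structure} (P A B : M) : Prop :=
  forall p, p ∈ P <-> exists a b, a ∈ A /\ b ∈ B /\ is_pair p a b.

Definition related {M : structure} (R x y : M) : Prop :=
  exists p, p ∈ R /\ is_pair p x y.

Definition is_relation {M : structure} (R A B : M) : Prop :=
  forall p, p ∈ R -> exists a b, a ∈ A /\ b ∈ B /\ is_pair p a b.

Definition is_function {M : structure} (f A B : M) : Prop :=
  is_relation f A B /\ forall x, x ∈ A -> exists! y, related f x y.

Definition is_bijection {M : structure} (f A B : M) : Prop :=
  is_function f A B /\
  (forall x x' y, related f x y -> related f x' y -> x = x') /\
  (forall y, y ∈ B -> exists x, related f x y).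

Definition is_binop {M : structure} (m A : M) : Prop :=
  exists P, is_prod P A A /\ is_function m P A.

(** [m (x, y) = z] *)
Definition binop_val {M : structure} (m x y z : M) : Prop :=
  exists p, is_pair p x y /\ related m p z.

Definition group_axioms {M : structure} (A m : M) : Prop :=
  is_binop m A /\
  (forall x y z xy yz w, binop_val m x y xy -> binop_val m y z yz ->
     (binop_val m xy z w <-> binop_val m x yz w)) /\
  (exists e, e ∈ A /\
     (forall x, x ∈ A -> binop_val m e x x /\ binop_val m x e x) /\
     (forall x, x ∈ A ->
        exists y, y ∈ A /\ binop_val m x y e /\ binop_val m y x e)).

Definition is_group {M : structure} (X : M) : Prop :=
  exists A m, is_pair X A m /\ group_axioms A m.

Definition isomorphic_groups {M : structure} (X Y : M) : Prop :=
  exists A m B n, is_pair X A m /\ is_pair Y B n /\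
  exists f, is_bijection f A B /\
    forall x y z x' y' z', binop_val m x y z ->
      related f x x' -> related f y y' -> related f z z' ->
      binop_val n x' y' z'.

Definition graph_axioms {M : structure} (V E : M) : Prop :=
  is_relation E V V /\
  (forall x y, related E x y -> related E y x) /\
  (forall x, ~ related E x x).

Definition is_graph {M : structure} (G : M) : Prop :=
  exists V E, is_pair G V E /\ graph_axioms V E.

Definition is_automorphism {M : structure} (f V E : M) : Prop :=
  is_bijection f V V /\
  forall x y x' y', related f x x' -> related f y y' ->
    (related E x y <-> related E x' y').

(** [h] is [f] after [g], for functions [f], [g], [h]. *)
Definition is_composite {M : structure} (h f g : M) : Prop :=
  forall x z, related h x z <-> exists y, related g x y /\ related f y z.

(** [X] is the group [Aut(G)]: the set of all automorphisms of [G] paired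
    with composition. *)
Definition is_Aut {M : structure} (X G : M) : Prop :=
  exists V E A m, is_pair G V E /\ is_pair X A m /\
  (forall f, f ∈ A <-> is_automorphism f V E) /\
  is_binop m A /\
  (forall f g h, f ∈ A -> g ∈ A -> h ∈ A ->
     (binop_val m f g h <-> is_composite h f g)).

(* Main.v *)
Require Import Defs.
From Stdlib Require Import Classical ClassicalEpsilon PeanoNat.

(** A Cayley graph whose edges are coloured by the elements of the group has
    exactly the left translations as automorphisms. The usual way to replace
    colours by subgraphs takes a family of rigid, pairwise non-isomorphic
    graphs from a well-ordering of the group, which only Choice provides. Here
    the colours are sets, and sets are rigid by themselves: an automorphism of
    the membership relation on a transitive set is the identity, by induction
    on membership.

    Let [A] be the underlying set of the group and [T] the transitive closure
    of the singleton of [A], so that every colour, and also [A], is a member of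
    [T]. Over each [x] in [A] stands a fiber, the membership relation of [T]
    written as a bipartite graph on vertices [elem x c] and [coll x d]. For each
    [c] in [A] an edge joins [elem x c] to [elem (x c) A]. A vertex called hub
    is joined to all [coll x d] and to one further vertex, the pendant, which is
    the only vertex of degree one ([leaf_is_pendant]). An automorphism therefore
    fixes the pendant and the hub and respects the two sides of the fibers. By
    induction on membership it maps each fiber to a fiber and keeps the labels
    ([fiber_step], [fiber_image]). Then the edges between fibers force it to be
    a left translation ([automorphism_is_translation]).

    The graph and the group have to be elements of the model, and the set
    existence axioms are schemas over formulas. So a calculus of definable
    predicates and operations comes first; it turns the usual notation for
    comprehension and images into instances of the schemas. The induction on
    membership is itself an appeal to Foundation for a set that must be
    separated by a formula. It is used for [automorphism_translation], where
    the automorphism is an element of the model. *)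

(** * Predicates definable by formulas *)

Section Definability.
Context {M : structure}.

Definition env := nat -> M.
Definition tail (r : env) : env := fun n => r (S n).

Definition lift (f : nat -> nat) (n : nat) : nat :=
  match n with O => O | S k => S (f k) end.

Fixpoint rename (f : nat -> nat) (p : formula) : formula :=
  match p with
  | FMem i j => FMem (f i) (f j)
  | FEq i j => FEq (f i) (f j)
  | FFalse => FFalse
  | FImp p q => FImp (rename f p) (rename f q)
  | FAnd p q => FAnd (rename f p) (rename f q)
  | FOr p q => FOr (rename f p) (rename f q)
  | FAll p => FAll (rename (lift f) p)
  | FEx p => FEx (rename (lift f) p)
  end.

Lemma sat_rename (p : formula) : forall (f : nat -> nat) (r s : env),
  (forall n, s n = r (f n)) -> sat r (rename f p) <-> sat s p.
Proof.
  assert (scons_lift : forall (f : nat -> nat) (r s : env) (x : M),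
    (forall n, s n = r (f n)) -> forall n, scons x s n = scons x r (lift f n))
    by (intros f r s x E [|n]; simpl; auto).
  induction p as [i j|i j| |p IHp q IHq|p IHp q IHq|p IHp q IHq|p IHp|p IHp];
    intros f r s E; simpl.
  - now rewrite !E.
  - now rewrite !E.
  - tauto.
  - now rewrite (IHp f r s E), (IHq f r s E).
  - now rewrite (IHp f r s E), (IHq f r s E).
  - now rewrite (IHp f r s E), (IHq f r s E).
  - split; intros H x; apply (IHp (lift f) (scons x r) (scons x s)); auto.
  - split; intros [x H]; exists x;
      apply (IHp (lift f) (scons x r) (scons x s)); auto.
Qed.

(** Free variables are read through a table that sends each of them to a
    variable of the ambient environment or to a fixed element of the model.
    Carrying the constants in the table lets definitions mention arbitrary
    elements of the model, without any order on the constants. *)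
Definition fetch (e : nat -> nat + M) (r : env) : env :=
  fun n => match e n with inl i => r i | inr c => c end.

Definition definable (P : env -> Prop) : Prop :=
  exists p e, forall r, P r <-> sat (fetch e r) p.

Lemma definable_iff (P Q : env -> Prop) :
  (forall r, P r <-> Q r) -> definable Q -> definable P.
Proof. intros E (p & e & H). exists p, e. intros r. now rewrite E. Qed.

(** The two tables are interleaved, so that the free variables of the first
    formula become even and those of the second one odd. *)
Lemma definable_binary (op : formula -> formula -> formula)
    (con : Prop -> Prop -> Prop) (P Q : env -> Prop) :
  (forall r p q, sat (M := M) r (op p q) <-> con (sat r p) (sat r q)) ->
  (forall A A' B B', (A <-> A') -> (B <-> B') -> (con A B <-> con A' B')) ->
  definable P -> definable Q -> definable (fun r => con (P r) (Q r)).
Proof.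
  intros Hop Hcon (p & e & Hp) (q & e' & Hq).
  exists (op (rename (fun n => 2 * n) p) (rename (fun n => S (2 * n)) q)).
  exists (fun n => if Nat.even n then e (Nat.div2 n) else e' (Nat.div2 n)).
  intros r. rewrite Hop. apply Hcon.
  - rewrite Hp. symmetry. apply sat_rename. intros n. unfold fetch.
    now rewrite Nat.even_even, Nat.div2_double.
  - rewrite Hq. symmetry. apply sat_rename. intros n. unfold fetch.
    replace (S (2 * n)) with (2 * n + 1) at 1 by apply Nat.add_1_r.
    now rewrite Nat.even_odd, Nat.div2_succ_double.
Qed.

Lemma definable_imp P Q :
  definable P -> definable Q -> definable (fun r => P r -> Q r).
Proof. apply (definable_binary FImp (fun A B => A -> B)); simpl; tauto. Qed.

Lemma definable_and P Q :
  definable P -> definable Q -> definable (fun r => P r /\ Q r).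
Proof. apply (definable_binary FAnd and); simpl; tauto. Qed.

Lemma definable_or P Q :
  definable P -> definable Q -> definable (fun r => P r \/ Q r).
Proof. apply (definable_binary FOr or); simpl; tauto. Qed.

Lemma definable_false : definable (fun _ => False).
Proof. exists FFalse, inl. simpl. tauto. Qed.

Lemma definable_not P : definable P -> definable (fun r => ~ P r).
Proof. intros H. now apply definable_imp, definable_false. Qed.

Lemma definable_equiv P Q :
  definable P -> definable Q -> definable (fun r => P r <-> Q r).
Proof. intros HP HQ. apply definable_and; now apply definable_imp. Qed.

(** The schemas of Separation and Replacement and the quantifiers push their
    bound variable in front of a valuation; this puts a definition into that
    form, whatever places the table gave to variable 0. *)
Lemma definable_under (Q : M -> env -> Prop) :
  definable (fun r => Q (r 0) (tail r)) ->
  exists p e, forall r x, Q x r <-> sat (scons x (fetch e r)) p.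
Proof.
  intros (p & e & H).
  exists (rename (fun n => match e n with inl O => O | _ => S n end) p).
  exists (fun n => match e n with inl (S i) => inl i | other => other end).
  intros r x. rewrite (H (scons x r)). symmetry. apply sat_rename.
  intros n. unfold fetch. destruct (e n) as [[|i]|c] eqn:E; simpl; now rewrite ?E.
Qed.

Lemma definable_all (Q : M -> env -> Prop) :
  definable (fun r => Q (r 0) (tail r)) -> definable (fun r => forall x, Q x r).
Proof.
  intros (p & e & H)%definable_under. exists (FAll p), e. intros r; simpl.
  split; intros K x; apply H, K.
Qed.

Lemma definable_ex (Q : M -> env -> Prop) :
  definable (fun r => Q (r 0) (tail r)) -> definable (fun r => exists x, Q x r).
Proof.
  intros (p & e & H)%definable_under. exists (FEx p), e. intros r; simpl.
  split; intros [x K]; exists x; apply H, K.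
Qed.

(** Freezing part of the environment to constants yields the instances with
    fixed elements of the model that Separation and Replacement apply to. *)
Lemma definable_instance (P : env -> Prop) (g : nat -> nat + M) :
  definable P -> definable (fun r => P (fetch g r)).
Proof.
  intros (p & e & H). exists p.
  exists (fun n => match e n with inl i => g i | other => other end).
  intros r. rewrite H. rewrite <- (sat_rename p (fun n => n)
    (fetch e (fetch g r)) (fetch e (fetch g r))) by reflexivity.
  apply sat_rename. intros n. unfold fetch. now destruct (e n).
Qed.

Lemma definable_reindex (P : env -> Prop) (f : nat -> nat) :
  definable P -> definable (fun r => P (fun n => r (f n))).
Proof. exact (definable_instance P (fun n => inl (f n))). Qed.

(** An operation is definable through its graph. As operations are total
    functions, every substitution instance of a definable predicate is again
    definable, so set operations can be nested inside formulas. *)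
Definition definable_term (t : env -> M) : Prop :=
  definable (fun r => r 0 = t (tail r)).

Lemma definable_var i : definable_term (fun r => r i).
Proof.
  exists (FEq 0 1), (fun n => match n with O => inl O | _ => inl (S i) end).
  intros r. reflexivity.
Qed.

Lemma definable_const c : definable_term (fun _ => c).
Proof.
  exists (FEq 0 1), (fun n => match n with O => inl O | _ => inr c end).
  intros r. reflexivity.
Qed.

Lemma definable_subst (Q : M -> env -> Prop) (t : env -> M) :
  definable (fun r => Q (r 0) (tail r)) -> definable_term t ->
  definable (fun r => Q (t r) r).
Proof.
  intros HQ Ht. apply definable_iff with (fun r => exists x, x = t r /\ Q x r).
  - intros r. split; [eauto | now intros (x & -> & K)].
  - apply definable_ex, definable_and; [exact Ht | exact HQ].
Qed.

Lemma definable_term_reindex t (f : nat -> nat) :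
  definable_term t -> definable_term (fun r => t (fun n => r (f n))).
Proof. intros H. exact (definable_reindex _ (lift f) H). Qed.

Lemma definable_mem t u :
  definable_term t -> definable_term u -> definable (fun r => t r ∈ u r).
Proof.
  intros Ht Hu. apply (definable_subst (fun x r => x ∈ u r)); [|exact Ht].
  apply (definable_subst (fun y r => r 0 ∈ y)).
  - exists (FMem 1 0), inl. reflexivity.
  - exact (definable_term_reindex u S Hu).
Qed.

Lemma definable_eq t u :
  definable_term t -> definable_term u -> definable (fun r => t r = u r).
Proof.
  intros Ht Hu. exact (definable_subst (fun x r => x = u r) t Hu Ht).
Qed.

(** The swap of 0 and 1 below puts the value before the argument, as in the
    graph of [s]. *)
Lemma definable_term_subst (s : M -> env -> M) (t : env -> M) :
  definable_term (fun r => s (r 0) (tail r)) -> definable_term t ->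
  definable_term (fun r => s (t r) r).
Proof.
  intros Hs Ht.
  apply (definable_subst (fun x r => r 0 = s x (tail r)) (fun r => t (tail r))).
  - apply (definable_reindex _ (fun n => match n with 0 => 1 | 1 => 0 | _ => n end)
      Hs).
  - exact (definable_term_reindex t S Ht).
Qed.

Definition definable_op1 (F : M -> M) := definable_term (fun r => F (r 0)).
Definition definable_op2 (F : M -> M -> M) :=
  definable_term (fun r => F (r 0) (r 1)).

Lemma definable_app1 F t :
  definable_op1 F -> definable_term t -> definable_term (fun r => F (t r)).
Proof. intros HF. exact (definable_term_subst (fun x _ => F x) t HF). Qed.

Lemma definable_app2 F t u :
  definable_op2 F -> definable_term t -> definable_term u ->
  definable_term (fun r => F (t r) (u r)).
Proof.
  intros HF Ht Hu.
  apply (definable_term_subst (fun x r => F x (u r)) t); [|exact Ht].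
  apply (definable_term_subst (fun y r => F (r 0) y)).
  - exact (definable_term_reindex _ (fun n => match n with 0 => 1 | _ => 0 end) HF).
  - exact (definable_term_reindex u S Hu).
Qed.

End Definability.

(** * Set operations of the model *)

Existing Class ZF.

Section Sets.
Context {M : structure} {HZF : ZF M}.

(** Operations are chosen outside the model. No choice principle enters the
    model, because each of them is applied to a description that determines
    its value, and is used in a formula only through that description. *)
Definition the (P : M -> Prop) : M :=
  epsilon (let (w, _) := zf_infinity M HZF in inhabits w) P.

Lemma the_spec P : (exists x, P x) -> P (the P).
Proof. apply epsilon_spec. Qed.

Lemma ext (a b : M) : (forall x, x ∈ a <-> x ∈ b) -> a = b.
Proof. exact (zf_extensionality M HZF a b). Qed.

(** By extensionality, the graph of an operation is the statement that
    membership in the value has the expected description. *)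
Lemma definable_by_members (t : env -> M) (Q : M -> env -> Prop) :
  (forall r x, x ∈ t r <-> Q x r) ->
  definable (fun r => Q (r 0) (tail r)) -> definable_term t.
Proof.
  intros E H.
  apply definable_iff with (fun r => forall x, x ∈ r 0 <-> Q x (tail r)).
  - intros r. split.
    + intros -> x. apply E.
    + intros K. apply ext. intros x. now rewrite K, E.
  - apply definable_all, definable_equiv.
    + apply definable_mem; apply definable_var.
    + exact (definable_reindex _
        (fun n => match n with 0 => 0 | S k => S (S k) end) H).
Qed.

Definition upair (a b : M) : M := the (fun c => is_upair c a b).
Lemma mem_upair a b x : x ∈ upair a b <-> x = a \/ x = b.
Proof. exact (the_spec _ (zf_pairing M HZF a b) x). Qed.

Definition Union (a : M) : M :=
  the (fun u => forall x, x ∈ u <-> exists y, x ∈ y /\ y ∈ a).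
Lemma mem_Union a x : x ∈ Union a <-> exists y, x ∈ y /\ y ∈ a.
Proof. exact (the_spec _ (zf_union M HZF a) x). Qed.

Definition sep (a : M) (P : M -> Prop) : M :=
  the (fun b => forall x, x ∈ b <-> x ∈ a /\ P x).
Lemma mem_sep a P x :
  definable (fun r => P (r 0)) -> x ∈ sep a P <-> x ∈ a /\ P x.
Proof.
  intros H. refine (the_spec (fun b => forall x, x ∈ b <-> x ∈ a /\ P x) _ x).
  destruct (definable_under (fun x _ => P x) H) as (p & e & K).
  destruct (zf_separation M HZF p (fetch e (fun _ => a)) a) as [b Hb].
  exists b. intros y. now rewrite Hb, (K (fun _ => a)).
Qed.

Lemma replacement (P : M -> M -> Prop) (a : M) :
  definable (fun r => P (r 0) (r 1)) ->
  (forall x y y', x ∈ a -> P x y -> P x y' -> y = y') ->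
  exists b, forall y, y ∈ b <-> exists x, x ∈ a /\ P x y.
Proof.
  intros (p & e & K) Hfun.
  set (q := rename (fun n => match e n with
    | inl 0 => 0 | inl 1 => 1 | _ => S (S n) end) p).
  set (r := fetch e (fun _ => a)).
  assert (E : forall x y, P x y <-> sat (scons x (scons y r)) q).
  { intros x y. rewrite (K (scons x (scons y (fun _ => a)))).
    symmetry. apply sat_rename. intros n. unfold r, fetch.
    destruct (e n) as [[|[|i]]|c] eqn:En; simpl; now rewrite ?En. }
  destruct (zf_replacement M HZF q r a) as [b Hb].
  - intros x y y' Hx H H'. apply (Hfun x); trivial; now apply E.
  - exists b. intros y. rewrite Hb.
    split; intros (x & Hx & H); exists x; split; trivial; now apply E.
Qed.

Definition image (a : M) (t : M -> M) : M :=
  the (fun b => forall y, y ∈ b <-> exists x, x ∈ a /\ y = t x).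
Lemma mem_image a t y :
  definable_term (fun r => t (r 0)) ->
  y ∈ image a t <-> exists x, x ∈ a /\ y = t x.
Proof.
  intros H. refine (the_spec (fun b =>
    forall z, z ∈ b <-> exists x, x ∈ a /\ z = t x) _ y).
  apply (replacement (fun x y => y = t x)).
  - exact (definable_reindex _ (fun n => match n with 0 => 1 | _ => 0 end) H).
  - now intros x y1 y2 _ -> ->.
Qed.

Lemma definable_sep (a : env -> M) (P : M -> env -> Prop) :
  definable_term a -> definable (fun r => P (r 0) (tail r)) ->
  definable_term (fun r => sep (a r) (fun x => P x r)).
Proof.
  intros Ha HP. apply (definable_by_members _ (fun x r => x ∈ a r /\ P x r)).
  - intros r x. apply mem_sep.
    exact (definable_instance _ (fun n =>
      match n with 0 => inl 0 | S k => inr (r k) end) HP).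
  - apply definable_and; [|exact HP].
    apply definable_mem; [apply definable_var|].
    exact (definable_term_reindex a S Ha).
Qed.

Lemma definable_image (a : env -> M) (t : M -> env -> M) :
  definable_term a -> definable_term (fun r => t (r 0) (tail r)) ->
  definable_term (fun r => image (a r) (fun x => t x r)).
Proof.
  intros Ha Ht.
  apply (definable_by_members _ (fun y r => exists x, x ∈ a r /\ y = t x r)).
  - intros r y. apply mem_image.
    exact (definable_instance _ (fun n =>
      match n with 0 => inl 0 | 1 => inl 1 | S (S k) => inr (r k) end) Ht).
  - apply definable_ex, definable_and.
    + apply definable_mem; [apply definable_var|].
      exact (definable_term_reindex a (fun k => S (S k)) Ha).
    + apply (definable_eq (fun r => r 1)); [apply definable_var|].
      exact (definable_term_reindex _
        (fun n => match n with 0 => 0 | S k => S (S k) end) Ht).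
Qed.

End Sets.

Create HintDb definable.

(** The order of the cases matters: a term that does not mention the
    environment is a constant even if it is a large expression, so its inner
    structure need not be definable. *)
Ltac definable :=
  cbv beta delta [tail];
  repeat (match goal with
  | |- definable (fun r => _ /\ _) => apply definable_and
  | |- definable (fun r => _ \/ _) => apply definable_or
  | |- definable (fun r => _ <-> _) => apply definable_equiv
  | |- definable (fun r => ~ _) => apply definable_not
  | |- definable (fun r => exists x, _) => apply definable_ex
  | |- definable (fun r => _ ∈ _) => apply definable_mem
  | |- definable (fun r => _ = _) => apply definable_eq
  | |- definable (fun r => _ -> _) => apply definable_imp
  | |- definable (fun r => forall x, _) => apply definable_all
  | |- definable_term (fun r => r ?i) => apply definable_var
  | |- definable_term (fun r => ?c) => apply definable_const
  | |- definable_term (fun r => ?F (@?t r) (@?u r)) =>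
      apply (definable_app2 F t u); [solve [auto with definable] | |]
  | |- definable_term (fun r => ?F (@?t r)) =>
      apply (definable_app1 F t); [solve [auto with definable] |]
  | |- definable_term _ => first [apply definable_sep | apply definable_image]
  end; cbv beta delta [tail]).

Section Constructions.
Context {M : structure} {HZF : ZF M}.

Lemma definable_upair : definable_op2 upair.
Proof.
  apply (definable_by_members _ (fun x r => x = r 0 \/ x = r 1)).
  - intros r x. apply mem_upair.
  - definable.
Qed.
Hint Resolve definable_upair : definable.

Lemma definable_Union : definable_op1 Union.
Proof.
  apply (definable_by_members _ (fun x r => exists y, x ∈ y /\ y ∈ r 0)).
  - intros r x. apply mem_Union.
  - definable.
Qed.
Hint Resolve definable_Union : definable.

Definition singleton (a : M) : M := upair a a.
Lemma mem_singleton a x : x ∈ singleton a <-> x = a.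
Proof. unfold singleton. rewrite mem_upair. tauto. Qed.
Lemma definable_singleton : definable_op1 singleton.
Proof. unfold definable_op1, singleton. definable. Qed.
Hint Resolve definable_singleton : definable.

Definition pair (a b : M) : M := upair (singleton a) (upair a b).
Lemma definable_pair : definable_op2 pair.
Proof. unfold definable_op2, pair. definable. Qed.
Hint Resolve definable_pair : definable.

Lemma is_upair_iff (c a b : M) : is_upair c a b <-> c = upair a b.
Proof.
  split; [|intros ->; exact (mem_upair a b)].
  intros H. apply ext. intros x. now rewrite (H x), mem_upair.
Qed.

Lemma is_pair_iff (p a b : M) : is_pair p a b <-> p = pair a b.
Proof.
  split.
  - intros (u & v & Hu & Hv & Hp). now rewrite !is_upair_iff in *; subst.
  - intros ->. exists (singleton a), (upair a b). now rewrite !is_upair_iff.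
Qed.

Lemma singleton_inj a b : singleton a = singleton b -> a = b.
Proof. intros H. apply mem_singleton. rewrite <- H. now apply mem_singleton. Qed.

Lemma upair_inj_r a b c : upair a b = upair a c -> b = c.
Proof.
  intros H. assert (Hb : b ∈ upair a c) by (rewrite <- H; apply mem_upair; auto).
  assert (Hc : c ∈ upair a b) by (rewrite H; apply mem_upair; auto).
  apply mem_upair in Hb, Hc. destruct Hb, Hc; congruence.
Qed.

Lemma pair_inj a b a' b' : pair a b = pair a' b' -> a = a' /\ b = b'.
Proof.
  intros H. assert (Ea : a = a').
  { assert (K : singleton a ∈ pair a' b') by (rewrite <- H; apply mem_upair; auto).
    assert (K' : singleton a' ∈ pair a b) by (rewrite H; apply mem_upair; auto).
    apply mem_upair in K as [K|K]; [now apply singleton_inj|].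
    symmetry. apply mem_singleton. rewrite K. apply mem_upair; auto. }
  subst a'. split; trivial. now apply (upair_inj_r a), (upair_inj_r (singleton a)).
Qed.

Definition cup (a b : M) : M := Union (upair a b).
Lemma mem_cup a b x : x ∈ cup a b <-> x ∈ a \/ x ∈ b.
Proof.
  unfold cup. rewrite mem_Union. split.
  - intros (y & Hx & [-> | ->]%mem_upair); auto.
  - intros [H|H]; eexists; (split; [exact H|]); apply mem_upair; auto.
Qed.
Lemma definable_cup : definable_op2 cup.
Proof. unfold definable_op2, cup. definable. Qed.
Hint Resolve definable_cup : definable.

Definition product (a b : M) : M :=
  Union (image a (fun x => image b (fun y => pair x y))).
Lemma mem_product a b z :
  z ∈ product a b <-> exists x y, x ∈ a /\ y ∈ b /\ z = pair x y.
Proof.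
  unfold product. rewrite mem_Union. split.
  - intros (s & Hz & Hs). rewrite mem_image in Hs by definable.
    destruct Hs as (x & Hx & ->). rewrite mem_image in Hz by definable.
    destruct Hz as (y & Hy & ->). eauto.
  - intros (x & y & Hx & Hy & ->). exists (image b (fun y => pair x y)).
    split; rewrite mem_image by definable; eauto.
Qed.

Lemma mem_product_pair a b x y : pair x y ∈ product a b <-> x ∈ a /\ y ∈ b.
Proof.
  rewrite mem_product. split; [|intros []; eauto 6].
  now intros (x' & y' & Hx & Hy & [-> ->]%pair_inj).
Qed.

Lemma is_prod_product a b : is_prod (product a b) a b.
Proof.
  intros p. rewrite mem_product.
  split; intros (x & y & Hx & Hy & H%is_pair_iff); eauto.
Qed.

Lemma is_prod_iff P a b : is_prod P a b <-> P = product a b.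
Proof.
  split; [|intros ->; apply is_prod_product].
  intros H. apply ext. intros p. now rewrite (H p), (is_prod_product a b p).
Qed.

Lemma related_iff (R x y : M) : related R x y <-> pair x y ∈ R.
Proof.
  split.
  - now intros (p & Hp & ->%is_pair_iff).
  - intros H. exists (pair x y). now rewrite is_pair_iff.
Qed.

Lemma binop_val_iff (m x y z : M) :
  binop_val m x y z <-> pair (pair x y) z ∈ m.
Proof.
  split.
  - now intros (p & ->%is_pair_iff & H%related_iff).
  - intros H. exists (pair x y). now rewrite is_pair_iff, related_iff.
Qed.

(** The union of all values of [f] at [x]: a total operation that agrees with
    application when [f] is a function and [x] is in its domain. *)
Definition app (f x : M) : M :=
  Union (sep (Union (Union f)) (fun y => pair x y ∈ f)).
Lemma definable_app : definable_op2 app.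
Proof. unfold definable_op2, app. definable. Qed.

Lemma app_eq f x y : (forall y', pair x y' ∈ f <-> y' = y) -> app f x = y.
Proof.
  intros H. unfold app.
  replace (sep _ _) with (singleton y).
  - apply ext. intros z. rewrite mem_Union. split.
    + now intros (u & Hz & ->%mem_singleton).
    + intros Hz. exists y. now rewrite mem_singleton.
  - apply ext. intros z. rewrite mem_singleton, mem_sep, H by definable.
    split; [|tauto]. intros ->. split; trivial.
    apply mem_Union. exists (upair x y). split; [apply mem_upair; auto|].
    apply mem_Union. exists (pair x y). split; [apply mem_upair; auto|].
    now apply H.
Qed.

Lemma app_graph f a b x y :
  is_function f a b -> pair x y ∈ f <-> x ∈ a /\ y = app f x.
Proof.
  intros [Hrel Hfun].
  assert (K : x ∈ a -> forall y, pair x y ∈ f <-> y = app f x).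
  { intros Hx. destruct (Hfun x Hx) as (z & Hz & Huniq).
    rewrite related_iff in Hz.
    assert (E : forall y', pair x y' ∈ f <-> y' = z).
    { intros y'. split; [|now intros ->]. intros H. symmetry.
      now apply Huniq, related_iff. }
    now rewrite (app_eq f x z E). }
  split.
  - intros H. destruct (Hrel _ H) as (x' & y' & Hx & _ & E%is_pair_iff).
    apply pair_inj in E as [-> ->]. split; trivial. now apply K.
  - intros [Hx ->]. now apply K.
Qed.

Lemma app_in f a b x : is_function f a b -> x ∈ a -> app f x ∈ b.
Proof.
  intros Hf Hx. assert (H : pair x (app f x) ∈ f) by now apply (app_graph f a b).
  destruct (proj1 Hf _ H) as (x' & y' & _ & Hy & E%is_pair_iff).
  apply pair_inj in E as [_ ->]. exact Hy.
Qed.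

Lemma image_function (a b : M) (t : M -> M) :
  definable_term (fun r => t (r 0)) -> (forall x, x ∈ a -> t x ∈ b) ->
  is_function (image a (fun x => pair x (t x))) a b.
Proof.
  intros Ht Hb.
  assert (D : definable_term (fun r => pair (r 0) (t (r 0))))
    by (apply definable_app2; auto using definable_pair, definable_var).
  split.
  - intros p (x & Hx & ->)%mem_image; [|exact D].
    exists x, (t x). rewrite is_pair_iff. auto.
  - intros x Hx. exists (t x). split.
    + apply related_iff, mem_image; eauto.
    + intros y H. apply related_iff, mem_image in H; [|exact D].
      now destruct H as (x' & _ & [-> ->]%pair_inj).
Qed.

Lemma foundation (a : M) :
  (exists x, x ∈ a) -> exists x, x ∈ a /\ forall y, y ∈ x -> y ∉ a.
Proof.
  intros H. destruct (zf_foundation M HZF a H) as (x & Hx & K).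
  exists x. split; eauto.
Qed.

Lemma mem_irrefl (x : M) : x ∉ x.
Proof.
  intros H. destruct (foundation (singleton x)) as (y & ->%mem_singleton & Hy).
  - exists x. now apply mem_singleton.
  - apply (Hy x H). now apply mem_singleton.
Qed.

Lemma mem_asym (x y : M) : x ∈ y -> y ∉ x.
Proof.
  intros H H'. destruct (foundation (upair x y)) as (z & Hz & K).
  - exists x. apply mem_upair; auto.
  - apply mem_upair in Hz as [-> | ->].
    + apply (K y H'). apply mem_upair; auto.
    + apply (K x H). apply mem_upair; auto.
Qed.

Definition succ (x : M) : M := cup x (singleton x).
Lemma mem_succ x y : y ∈ succ x <-> y ∈ x \/ y = x.
Proof. unfold succ. now rewrite mem_cup, mem_singleton. Qed.
Lemma definable_succ : definable_op1 succ.
Proof. unfold definable_op1, succ. definable. Qed.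

Lemma succ_inj x y : succ x = succ y -> x = y.
Proof.
  intros H.
  assert (Hx : x ∈ succ y) by (rewrite <- H; apply mem_succ; auto).
  assert (Hy : y ∈ succ x) by (rewrite H; apply mem_succ; auto).
  apply mem_succ in Hx as [Hx|Hx], Hy as [Hy|Hy]; trivial; try easy.
  now destruct (mem_asym x y).
Qed.

Definition empty : M := the (fun e => forall x, x ∉ e).
Lemma not_mem_empty x : x ∉ empty.
Proof.
  refine (the_spec (fun e => forall x, x ∉ e) _ x).
  destruct (zf_infinity M HZF) as (w & (e & _ & He) & _). eauto.
Qed.

End Constructions.

#[export] Hint Resolve definable_upair definable_Union definable_singleton
  definable_pair definable_cup definable_app definable_succ : definable.

(** * Transitive closures *)

Section TransitiveSets.
Context {M : structure} {HZF : ZF M}.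

Definition transitive (T : M) : Prop := forall x y, x ∈ y -> y ∈ T -> x ∈ T.

(** Foundation only speaks of sets, so the induction is confined to a set and
    to definable properties: the counterexamples then form a set. *)
Lemma mem_induction (T : M) (P : M -> Prop) :
  definable (fun r => P (r 0)) ->
  (forall y, y ∈ T -> (forall c, c ∈ y -> c ∈ T -> P c) -> P y) ->
  forall y, y ∈ T -> P y.
Proof.
  intros D step y Hy. apply NNPP. intros Hn.
  assert (D' : definable (fun r => ~ P (r 0))) by now apply definable_not.
  destruct (foundation (sep T (fun y => ~ P y))) as (z & Hz & Hmin).
  - exists y. now apply mem_sep.
  - apply mem_sep in Hz as [Hz Hnz]; [|exact D']. apply Hnz, step; trivial.
    intros c Hc HcT. apply NNPP. intros Hnc. apply (Hmin c Hc).
    now apply mem_sep.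
Qed.

(** A piece of the sequence a0 = {a}, a1 = Union a0, a2 = Union a1, and so on:
    every entry is justified by an earlier entry of the same piece. *)
Definition thread (a g : M) : Prop :=
  forall k z, pair k z ∈ g ->
    (k = empty /\ z = singleton a) \/
    exists j w, pair j w ∈ g /\ k = succ j /\ z = Union w.

(** Induction on the index with respect to membership, since the indices need
    not be natural numbers; the double union of the first thread contains all
    its indices. *)
Lemma thread_unique (a g g' k z z' : M) :
  thread a g -> thread a g' -> pair k z ∈ g -> pair k z' ∈ g' -> z = z'.
Proof.
  intros Hg Hg' H H'.
  assert (Hk : k ∈ Union (Union g)).
  { apply mem_Union. exists (singleton k). split; [now apply mem_singleton|].
    apply mem_Union. exists (pair k z). split; [apply mem_upair; auto|trivial]. }
  revert z z' H H'.
  apply (mem_induction (Union (Union g)) (fun k => forall z z',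
    pair k z ∈ g -> pair k z' ∈ g' -> z = z')); trivial; [definable|].
  clear k Hk. intros k _ IH z z' H H'.
  destruct (Hg _ _ H) as [[-> ->]|(j & w & Hj & -> & ->)],
    (Hg' _ _ H') as [[E ->]|(j' & w' & Hj' & E & ->)]; trivial.
  - destruct (not_mem_empty j'). rewrite E. apply mem_succ; auto.
  - destruct (not_mem_empty j). rewrite <- E. apply mem_succ; auto.
  - apply succ_inj in E as <-. f_equal. apply (IH j); trivial.
    + apply mem_succ; auto.
    + apply mem_Union. exists (singleton j). split; [now apply mem_singleton|].
      apply mem_Union. exists (pair j w). split; [apply mem_upair; auto|trivial].
Qed.

Definition level (a n y : M) : Prop := exists g, thread a g /\ pair n y ∈ g.

Lemma level_unique a n y y' : level a n y -> level a n y' -> y = y'.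
Proof.
  intros (g & Hg & H) (g' & Hg' & H').
  exact (thread_unique a g g' n y y' Hg Hg' H H').
Qed.

Lemma level_empty a : level a empty (singleton a).
Proof.
  exists (singleton (pair empty (singleton a))). split; [|now apply mem_singleton].
  intros k z H%mem_singleton%pair_inj. auto.
Qed.

Lemma level_succ a n y : level a n y -> level a (succ n) (Union y).
Proof.
  intros (g & Hg & H).
  exists (cup g (singleton (pair (succ n) (Union y)))). split.
  - intros k z [Hk|Hk%mem_singleton%pair_inj]%mem_cup.
    + destruct (Hg _ _ Hk) as [?|(j & w & Hj & E)]; [now left|right].
      exists j, w. rewrite mem_cup. auto.
    + right. exists n, y. rewrite mem_cup. auto.
  - apply mem_cup. right. now apply mem_singleton.
Qed.

(** The iterated unions over the indices from any inductive set are collected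
    by Replacement; an inductive set larger than the natural numbers only adds
    indices, and those that carry no entry contribute nothing. *)
Lemma transitive_superset (a : M) : exists T, transitive T /\ a ∈ T.
Proof.
  destruct (zf_infinity M HZF) as (w & (e & Hew & He) & Hw).
  assert (e = empty) as ->.
  { apply ext. intros x. split; intros H; [now destruct (He x)|].
    now destruct (not_mem_empty x). }
  destruct (replacement (level a) w) as [b Hb].
  { unfold level, thread. definable. }
  { intros n y y' _. apply level_unique. }
  exists (Union b). split.
  - intros x y Hxy (z & Hyz & (n & Hn & Hz)%Hb)%mem_Union. apply mem_Union.
    exists (Union z). split; [apply mem_Union; eauto|]. apply Hb.
    destruct (Hw n Hn) as (s & Hs & E). exists s. split; trivial.
    replace s with (succ n); [now apply level_succ|].
    apply ext. intros u. now rewrite E, mem_succ.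
  - apply mem_Union. exists (singleton a). rewrite mem_singleton, Hb.
    eauto using level_empty.
Qed.

(** The last clause holds for the least transitive set containing [a]: the
    members which satisfy it again form a transitive set containing [a]. *)
Lemma transitive_closure (a : M) :
  exists T, transitive T /\ a ∈ T /\
    forall c, c ∈ T -> c = a \/ exists d, d ∈ T /\ c ∈ d.
Proof.
  destruct (transitive_superset a) as (T0 & HT0 & Ha0).
  set (least := fun c => forall S, transitive S -> a ∈ S -> c ∈ S).
  assert (D : definable (fun r => least (r 0)))
    by (unfold least, transitive; definable).
  set (T := sep T0 least).
  assert (HT : forall c, c ∈ T <-> least c).
  { intros c. unfold T. rewrite mem_sep by exact D.
    split; [tauto|]. intros H. split; trivial. now apply H. }
  assert (Htrans : transitive T).
  { intros x y Hxy Hy%HT. apply HT. intros S HS HaS.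
    apply (HS x y Hxy). now apply Hy. }
  assert (HaT : a ∈ T) by (apply HT; now intros S).
  exists T. split; [exact Htrans|]. split; [exact HaT|].
  intros c Hc%HT.
  assert (D' : definable (fun r => r 0 = a \/ exists d, d ∈ T /\ r 0 ∈ d))
    by definable.
  specialize (Hc (sep T (fun c => c = a \/ exists d, d ∈ T /\ c ∈ d))).
  rewrite (mem_sep T _ c D') in Hc. apply Hc.
  - intros x y Hxy [Hy _]%mem_sep; [|exact D'].
    apply mem_sep; [exact D'|]. split; [now apply (Htrans x y)|eauto].
  - apply mem_sep; [exact D'|]. auto.
Qed.

Lemma empty_mem_transitive (T x : M) : transitive T -> x ∈ T -> empty ∈ T.
Proof.
  intros HT Hx. destruct (foundation T) as (e & He & Hmin); [eauto|].
  replace empty with e; trivial. apply ext. intros y. split; intros Hy.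
  - destruct (Hmin y Hy). now apply (HT y e).
  - now destruct (not_mem_empty y).
Qed.
End TransitiveSets.

(** * The labelled Cayley graph *)

Section LabelledCayleyGraph.
Context {M : structure} {HZF : ZF M}.
Context (A T one : M) (mul : M -> M -> M).

(** The fiber over [x] is the bipartite membership graph of [T]: a set [c]
    occurs in it as the element [elem x c] and as the collection [coll x c].
    The hub singles out the collections, and the pendant singles out the hub. *)
Inductive vertex : Type :=
| pendant | hub
| elem (x c : M)
| coll (x c : M).

Definition valid (v : vertex) : Prop :=
  match v with
  | pendant | hub => True
  | elem x c | coll x c => x ∈ A /\ c ∈ T
  end.

(** Orientation only serves to list every edge once. Besides the members of
    [d], the collection [d] also sees [elem x d], which ties the two copies of
    [d] together. In [arc_mul] the target label [A] can be told from the source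
    label, since [A] is not a member of [A]; hence this edge has a direction
    and determines [c], although the graph is undirected. *)
Inductive arc : vertex -> vertex -> Prop :=
| arc_pendant : arc pendant hub
| arc_hub x c : arc hub (coll x c)
| arc_member x c d : c ∈ d \/ c = d -> arc (elem x c) (coll x d)
| arc_mul x c : c ∈ A -> arc (elem x c) (elem (mul x c) A).

Definition adj (u v : vertex) : Prop :=
  valid u /\ valid v /\ (arc u v \/ arc v u).

Definition translate (g : M) (v : vertex) : vertex :=
  match v with
  | pendant => pendant | hub => hub
  | elem x c => elem (mul g x) c
  | coll x c => coll (mul g x) c
  end.

Lemma adj_sym u v : adj u v -> adj v u.
Proof. unfold adj. tauto. Qed.

Lemma adj_irrefl v : ~ adj v v.
Proof.
  intros (_ & _ & [H|H]); inversion H; subst; now apply (mem_irrefl A).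
Qed.

Lemma adj_pendant v : adj pendant v <-> v = hub.
Proof.
  split.
  - intros (_ & _ & [H|H]); now inversion H.
  - intros ->. repeat split. left. constructor.
Qed.

Lemma adj_hub v : adj hub v <-> v = pendant \/ exists x c, valid v /\ v = coll x c.
Proof.
  split.
  - intros (_ & V & [H|H]); inversion H; subst; eauto.
  - intros [-> | (x & c & V & ->)]; repeat split; try apply V.
    + right; constructor.
    + left; constructor.
Qed.

Lemma adj_member x c y d :
  adj (elem x c) (coll y d) <->
  x = y /\ x ∈ A /\ c ∈ T /\ d ∈ T /\ (c ∈ d \/ c = d).
Proof.
  split.
  - intros ([Hx Hc] & [Hy Hd] & [H|H]); inversion H; subst; auto.
  - intros (<- & Hx & Hc & Hd & H). repeat split; trivial. left. now constructor.
Qed.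

Lemma adj_coll v x c : adj v (coll x c) -> v = hub \/ exists d, v = elem x d.
Proof. intros (_ & _ & [H|H]); inversion H; subst; eauto. Qed.

Lemma adj_mul x c y :
  c ∈ A -> adj (elem x c) (elem y A) -> y = mul x c.
Proof.
  intros Hc (_ & _ & [H|H]); inversion H; subst; trivial.
  now destruct (mem_irrefl A).
Qed.

Context (one_in : one ∈ A) (mul_in : forall x y, x ∈ A -> y ∈ A -> mul x y ∈ A)
  (mul_1_l : forall x, x ∈ A -> mul one x = x)
  (mul_1_r : forall x, x ∈ A -> mul x one = x)
  (mul_assoc : forall x y z, x ∈ A -> y ∈ A -> z ∈ A ->
     mul (mul x y) z = mul x (mul y z))
  (mul_inv : forall x, x ∈ A ->
     exists y, y ∈ A /\ mul x y = one /\ mul y x = one).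

Lemma mul_cancel_l g x y :
  g ∈ A -> x ∈ A -> y ∈ A -> mul g x = mul g y -> x = y.
Proof.
  intros Hg Hx Hy E. destruct (mul_inv g Hg) as (h & Hh & _ & Ehg).
  now rewrite <- (mul_1_l x), <- (mul_1_l y), <- Ehg, !mul_assoc, E by trivial.
Qed.

Lemma translate_valid g v : g ∈ A -> valid v -> valid (translate g v).
Proof. destruct v; simpl; intuition. Qed.

Lemma translate_inj g u v :
  g ∈ A -> valid u -> valid v -> translate g u = translate g v -> u = v.
Proof.
  intros Hg. destruct u, v; simpl; try discriminate; trivial;
    intros [] [] E; injection E as E ->; f_equal; now apply (mul_cancel_l g).
Qed.

Lemma translate_mul g h v :
  g ∈ A -> h ∈ A -> valid v ->
  translate (mul g h) v = translate g (translate h v).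
Proof.
  intros Hg Hh. destruct v; simpl; trivial;
    intros []; f_equal; now apply mul_assoc.
Qed.

Lemma translate_one v : valid v -> translate one v = v.
Proof. destruct v; simpl; trivial; intros []; f_equal; now apply mul_1_l. Qed.

Lemma translate_surj g v :
  g ∈ A -> valid v -> exists u, valid u /\ translate g u = v.
Proof.
  intros Hg Hv. destruct (mul_inv g Hg) as (h & Hh & E & _).
  exists (translate h v). split; [now apply translate_valid|].
  now rewrite <- translate_mul, E, translate_one.
Qed.

Lemma translate_adj_forward g u v :
  g ∈ A -> adj u v -> adj (translate g u) (translate g v).
Proof.
  intros Hg.
  assert (K : forall u v, valid u -> valid v ->
    arc u v -> arc (translate g u) (translate g v)).
  { intros u' v' Hu Hv H. destruct H; simpl in *; try now constructor.
    rewrite <- mul_assoc by tauto. now constructor. }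
  intros (Hu & Hv & H). repeat split; try now apply translate_valid.
  destruct H; auto.
Qed.

Lemma translate_adj g u v :
  g ∈ A -> valid u -> valid v ->
  adj u v <-> adj (translate g u) (translate g v).
Proof.
  intros Hg Hu Hv. split; [now apply translate_adj_forward|].
  intros H. destruct (mul_inv g Hg) as (h & Hh & _ & E).
  apply (translate_adj_forward h) in H; trivial.
  now rewrite <- !translate_mul, E, !translate_one in H.
Qed.

Context (T_trans : transitive T) (T_A : A ∈ T)
  (T_cofinal : forall c, c ∈ T -> c = A \/ exists d, d ∈ T /\ c ∈ d).

Lemma A_sub_T x : x ∈ A -> x ∈ T.
Proof. intros H. now apply (T_trans x A). Qed.

Section Automorphism.
Context (F : vertex -> vertex)
  (F_valid : forall v, valid v -> valid (F v))
  (F_inj : forall u v, valid u -> valid v -> F u = F v -> u = v)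
  (F_surj : forall w, valid w -> exists v, valid v /\ F v = w)
  (F_adj : forall u v, valid u -> valid v -> adj u v <-> adj (F u) (F v)).

Definition leaf (v : vertex) : Prop :=
  forall u w, adj v u -> adj v w -> u = w.

(** This is where closure matters: a label other than [A] belongs to another
    label [d], so an element vertex sees two collections, and [elem x A] has
    the edge coming from [elem x one]. *)
Lemma leaf_is_pendant v : valid v -> leaf v -> v = pendant.
Proof.
  intros Hv L. pose proof A_sub_T as HAT.
  destruct v as [| |x c|x c]; trivial; exfalso.
  - enough (pendant = coll one A) by discriminate. apply L; apply adj_hub; auto.
    right. exists one, A. simpl. auto.
  - destruct Hv as [Hx Hc], (T_cofinal c Hc) as [-> | (d & Hd & Hcd)].
    + enough (coll x A = elem x one) by discriminate. apply L.
      * apply adj_member. auto 8.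
      * split; [now split; auto|]. split; [now split; auto|].
        right. rewrite <- (mul_1_r x Hx) at 2. now constructor.
    + enough (E : coll x c = coll x d).
      { injection E as ->. now apply (mem_irrefl d). }
      apply L; apply adj_member; auto 8.
  - destruct Hv as [Hx Hc]. enough (hub = elem x c) by discriminate.
    apply L; apply adj_sym.
    + apply adj_hub. simpl. eauto 8.
    + apply adj_member. auto 8.
Qed.

Lemma F_pendant : F pendant = pendant.
Proof.
  apply leaf_is_pendant; [now apply F_valid|]. intros u w Hu Hw.
  destruct (F_surj u) as (u' & Vu & <-); [apply Hu|].
  destruct (F_surj w) as (w' & Vw & <-); [apply Hw|].
  apply F_adj, adj_pendant in Hu, Hw; try exact I; trivial. congruence.
Qed.

Lemma F_hub : F hub = hub.
Proof.
  apply adj_pendant. rewrite <- F_pendant.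
  apply -> F_adj; try exact I. now apply adj_pendant.
Qed.

Lemma F_coll x c : valid (coll x c) -> exists x' c', F (coll x c) = coll x' c'.
Proof.
  intros V. assert (H : adj hub (coll x c)) by (apply adj_hub; eauto 8).
  apply F_adj in H; trivial; [|exact I]. rewrite F_hub in H.
  apply adj_hub in H as [H|(x' & c' & _ & H)]; [|eauto].
  rewrite <- F_pendant in H. now apply F_inj in H.
Qed.

Lemma F_elem x c : valid (elem x c) -> exists x' c', F (elem x c) = elem x' c'.
Proof.
  intros V. destruct (F (elem x c)) as [| |x' c'|x' c'] eqn:E; [| |eauto|]; exfalso.
  - rewrite <- F_pendant in E. now apply F_inj in E.
  - rewrite <- F_hub in E. now apply F_inj in E.
  - assert (H : adj hub (F (elem x c))).
    { pose proof (F_valid _ V). apply adj_hub. rewrite E in *. eauto 8. }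
    rewrite <- F_hub in H. apply F_adj, adj_hub in H; trivial; [|exact I].
    now destruct H as [|(? & ? & _ & ?)].
Qed.

Definition moves_fiber_point (x s y : M) : Prop :=
  F (elem x y) = elem s y /\ F (coll x y) = coll s y.

(** The step of the induction that makes a fiber rigid. Let [coll s w] and
    [elem s b] be the images of the two copies of [y]. Since the labels below
    [y] are fixed, comparing neighbourhoods gives that [w] with the point [w]
    added equals [y] with the point [b] added. If [w] were in [y], then
    [coll x w] and [coll x y] would have the same image; so [w] is [b], and
    removing this point on both sides gives [w = y].

    The collection of a nonempty [y] is joined to its members, so it stays in
    the fiber over [s]. For [y] empty, that fiber is given by the hypothesis
    on the image of [elem x empty]. *)
Lemma fiber_step x s y v :
  x ∈ A -> F (elem x empty) = elem s v -> y ∈ T ->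
  (forall c, c ∈ y -> c ∈ T -> moves_fiber_point x s c) ->
  moves_fiber_point x s y.
Proof.
  intros Hx Es Hy IH.
  destruct (F_elem x y) as (s0 & b & E0); [now split|].
  destruct (F_coll x y) as (s1 & w & E1); [now split|].
  assert (V1 : valid (coll s1 w)) by (rewrite <- E1; now apply F_valid).
  destruct V1 as [Hs1 Hw].
  assert (below : forall c, c ∈ y -> s = s1 /\ (c ∈ w \/ c = w)).
  { intros c Hc. assert (HcT : c ∈ T) by now apply (T_trans c y).
    assert (H : adj (elem x c) (coll x y)) by (apply adj_member; auto 8).
    apply F_adj in H; try now split. destruct (IH c Hc HcT) as [E _].
    rewrite E, E1 in H. apply adj_member in H. tauto. }
  assert (H : adj (F (elem x y)) (F (coll x y))).
  { apply -> F_adj; try now split. apply adj_member. auto 8. }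
  rewrite E0, E1 in H. apply adj_member in H as (-> & _ & Hb & _ & Hbw).
  assert (s1 = s) as ->.
  { destruct (classic (exists c, c ∈ y)) as [[c Hc]|Hne].
    - symmetry. now apply (below c).
    - assert (y = empty) as ->.
      { apply ext. intros c. split; intros Hc; [now destruct Hne; exists c|].
        now destruct (not_mem_empty c). }
      congruence. }
  assert (b_notin : b ∉ y).
  { intros Hby. destruct (IH b Hby Hb) as [E _]. rewrite <- E0 in E.
    apply F_inj in E; try now split. injection E as ->. now apply (mem_irrefl y). }
  assert (above : forall c, c ∈ w \/ c = w -> c ∈ y \/ c = b).
  { intros c Hc. assert (HcT : c ∈ T).
    { destruct Hc as [Hc | ->]; trivial. now apply (T_trans c w). }
    assert (H : adj (elem s c) (F (coll x y)))
      by (rewrite E1; apply adj_member; auto 8).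
    destruct (F_surj (elem s c)) as (v' & V' & E'); [now split|].
    rewrite <- E' in H. apply F_adj in H; trivial; [|now split].
    destruct (adj_coll _ _ _ H) as [-> | (d & ->)].
    - rewrite F_hub in E'. discriminate.
    - apply adj_member in H as (_ & _ & Hd & _ & [Hdy | ->]).
      + left. destruct (IH d Hdy Hd) as [E _].
        rewrite E' in E. now injection E as ->.
      + right. rewrite E' in E0. now injection E0 as ->. }
  assert (w = b) as ->.
  { destruct (above w (or_intror eq_refl)) as [Hwy|]; trivial. exfalso.
    destruct (IH w Hwy Hw) as [_ E]. rewrite <- E1 in E.
    apply F_inj in E; try now split. injection E as ->. now apply (mem_irrefl y). }
  assert (b = y) as ->; [|now split].
  apply ext. intros c. split; intros Hc.
  - destruct (above c (or_introl Hc)) as [? | ->]; trivial.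
    now destruct (mem_irrefl b).
  - destruct (below c Hc) as [_ [? | ->]]; trivial. now destruct b_notin.
Qed.

(** The map [F] lives outside the model, so a definable property can match the
    induction statement only where the vertices involved are valid. *)
Context (F_definable : forall x s, x ∈ A ->
  exists P : M -> Prop, definable (fun r => P (r 0)) /\
    forall y, y ∈ T -> P y <-> moves_fiber_point x s y).

Lemma fiber_image x : x ∈ A ->
  exists s, s ∈ A /\ forall y, y ∈ T -> moves_fiber_point x s y.
Proof.
  intros Hx.
  assert (H0 : empty ∈ T) by now apply (empty_mem_transitive T A).
  destruct (F_elem x empty) as (s & v & E); [now split|].
  exists s. split.
  - assert (V : valid (F (elem x empty))) by (apply F_valid; now split).
    rewrite E in V. apply V.
  - destruct (F_definable x s Hx) as (P & D & HP).
    assert (K : forall y, y ∈ T -> P y).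
    { apply mem_induction; [exact D|]. intros y Hy IH.
      apply HP, (fiber_step x s y v); trivial.
      intros c Hc HcT. apply HP; auto. }
    intros y Hy. apply HP; auto.
Qed.

(** The fiber over [one] goes to the fiber over some [g], and the edge from
    [elem one x] to [elem x A] then forces the fiber over [x] to go to the
    fiber over the product of [g] and [x]. *)
Theorem automorphism_is_translation :
  exists g, g ∈ A /\ forall v, valid v -> F v = translate g v.
Proof.
  destruct (fiber_image one one_in) as (g & Hg & Hfix).
  exists g. split; trivial.
  assert (K : forall x y, x ∈ A -> y ∈ T -> moves_fiber_point x (mul g x) y).
  { intros x y Hx Hy. destruct (fiber_image x Hx) as (s & Hs & Hfix').
    replace (mul g x) with s; [now apply Hfix'|].
    pose proof (A_sub_T x Hx) as HxT. apply (adj_mul g x s Hx).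
    rewrite <- (proj1 (Hfix x HxT)), <- (proj1 (Hfix' A T_A)).
    apply -> F_adj; try now split.
    split; [now split|]. split; [now split|]. left.
    rewrite <- (mul_1_l x Hx) at 2. now constructor. }
  intros [| |x c|x c]; simpl.
  - intros _. apply F_pendant.
  - intros _. apply F_hub.
  - intros [Hx Hc]. now apply K.
  - intros [Hx Hc]. now apply K.
Qed.

End Automorphism.
End LabelledCayleyGraph.

(** * The graph and its automorphism group as sets *)

Section Encoding.
Context {M : structure} {HZF : ZF M}.

Definition tag_hub : M := singleton (singleton empty).
Definition tag_pendant : M := singleton tag_hub.

Definition code (v : vertex) : M :=
  match v with
  | pendant => pair empty tag_pendant
  | hub => pair empty tag_hub
  | elem x c => pair (pair x c) empty
  | coll x c => pair (pair x c) (singleton empty)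
  end.

Lemma singleton_ne_empty x : singleton x <> empty.
Proof.
  intros H. apply (not_mem_empty x). rewrite <- H. now apply mem_singleton.
Qed.

Lemma code_inj u v : code u = code v -> u = v.
Proof.
  assert (N : forall x, empty <> singleton x)
    by (intros x H; now apply (singleton_ne_empty x)).
  pose proof singleton_ne_empty as N'.
  destruct u, v; intros [E E']%pair_inj; unfold tag_pendant, tag_hub in E';
    repeat apply singleton_inj in E'; trivial;
    try (now destruct (N _ E')); try (now destruct (N' _ E')).
  - now apply pair_inj in E as [-> ->].
  - now apply pair_inj in E as [-> ->].
Qed.

Context (A T one : M) (mul : M -> M -> M)
  (mul_definable : definable_op2 mul)
  (one_in : one ∈ A) (mul_in : forall x y, x ∈ A -> y ∈ A -> mul x y ∈ A)
  (mul_1_l : forall x, x ∈ A -> mul one x = x)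
  (mul_1_r : forall x, x ∈ A -> mul x one = x)
  (mul_assoc : forall x y z, x ∈ A -> y ∈ A -> z ∈ A ->
     mul (mul x y) z = mul x (mul y z))
  (mul_inv : forall x, x ∈ A ->
     exists y, y ∈ A /\ mul x y = one /\ mul y x = one)
  (T_trans : transitive T) (T_A : A ∈ T)
  (T_cofinal : forall c, c ∈ T -> c = A \/ exists d, d ∈ T /\ c ∈ d).

Local Notation valid := (valid A T).
Local Notation adjacent := (adj A T mul).
Local Notation translate := (translate mul).

Definition vertices : M :=
  cup (product (product A T) (upair empty (singleton empty)))
      (upair (code pendant) (code hub)).

Lemma mem_vertices z : z ∈ vertices <-> exists v, valid v /\ z = code v.
Proof.
  unfold vertices. rewrite mem_cup, mem_product, mem_upair. split.
  - intros [(u & i & Hu & Hi & ->)|[-> | ->]].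
    + apply mem_product in Hu as (x & c & Hx & Hc & ->).
      apply mem_upair in Hi as [-> | ->];
        [exists (elem x c) | exists (coll x c)]; now repeat split.
    + now exists pendant.
    + now exists hub.
  - intros (v & V & ->). destruct v as [| |x c|x c]; auto; left.
    + exists (pair x c), empty.
      rewrite mem_product_pair, mem_upair. simpl in V. auto.
    + exists (pair x c), (singleton empty).
      rewrite mem_product_pair, mem_upair. simpl in V. auto.
Qed.

Lemma code_mem_vertices v : code v ∈ vertices <-> valid v.
Proof.
  rewrite mem_vertices. split; [|eauto].
  now intros (w & V & ->%code_inj).
Qed.

(** The relation [arc] has to be restated on codes, because formulas quantify
    over sets and not over vertices. *)
Definition coded_arc (z : M) : Prop :=
  z = pair (code pendant) (code hub) \/
  exists x c,
    z = pair (code hub) (code (coll x c)) \/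
    (exists d, (c ∈ d \/ c = d) /\ z = pair (code (elem x c)) (code (coll x d))) \/
    (c ∈ A /\ z = pair (code (elem x c)) (code (elem (mul x c) A))).

Lemma coded_arc_iff u v : coded_arc (pair (code u) (code v)) <-> arc A mul u v.
Proof.
  unfold coded_arc. split.
  - intros [E|(x & c & [E|[(d & H & E)|[H E]]])];
      apply pair_inj in E as [->%code_inj ->%code_inj]; now constructor.
  - intros []; eauto 10.
Qed.

Definition edges : M :=
  sep (product vertices vertices) (fun e => exists a b,
    e = pair a b /\ (coded_arc (pair a b) \/ coded_arc (pair b a))).

Lemma mem_edges u v : pair (code u) (code v) ∈ edges <-> adjacent u v.
Proof.
  unfold edges. rewrite mem_sep, mem_product_pair, !code_mem_vertices
    by (unfold coded_arc; simpl code; definable).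
  unfold adj. rewrite <- !coded_arc_iff. split.
  - intros ([Hu Hv] & a & b & E & H). apply pair_inj in E as [<- <-]. auto.
  - intros (Hu & Hv & H). eauto 6.
Qed.

Lemma edge_endpoints e : e ∈ edges ->
  exists u v, valid u /\ valid v /\ e = pair (code u) (code v).
Proof.
  intros [H _]%mem_sep; [|unfold coded_arc; simpl code; definable].
  apply mem_product in H as (a & b & (u & Hu & ->)%mem_vertices &
    (v & Hv & ->)%mem_vertices & ->). eauto 6.
Qed.

Lemma related_edges x y : related edges x y <->
  exists u v, x = code u /\ y = code v /\ adjacent u v.
Proof.
  rewrite related_iff. split.
  - intros H. destruct (edge_endpoints _ H) as (u & v & _ & _ & E).
    apply pair_inj in E as [-> ->]. exists u, v. now rewrite <- mem_edges.
  - intros (u & v & -> & -> & H). now apply mem_edges.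
Qed.

Lemma graph_axioms_edges : graph_axioms vertices edges.
Proof.
  split; [|split].
  - intros e (u & v & Hu & Hv & ->)%edge_endpoints.
    exists (code u), (code v). now rewrite !code_mem_vertices, is_pair_iff.
  - intros x y (u & v & -> & -> & H)%related_edges.
    apply related_edges. exists v, u. auto using adj_sym.
  - intros x (u & v & -> & <-%code_inj & H)%related_edges.
    now apply adj_irrefl in H.
Qed.

Definition translation (g : M) : M :=
  sep (product vertices vertices) (fun e =>
    e = pair (code pendant) (code pendant) \/ e = pair (code hub) (code hub) \/
    exists x c,
      e = pair (code (elem x c)) (code (elem (mul g x) c)) \/
      e = pair (code (coll x c)) (code (coll (mul g x) c))).

Lemma definable_translation : definable_op1 translation.
Proof. unfold definable_op1, translation. simpl code. definable. Qed.

Lemma mem_translation g e : g ∈ A ->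
  e ∈ translation g <->
  exists v, valid v /\ e = pair (code v) (code (translate g v)).
Proof.
  intros Hg. unfold translation. rewrite mem_sep by (simpl code; definable).
  split.
  - intros [H K].
    assert (exists v, e = pair (code v) (code (translate g v))) as [v ->].
    { destruct K as [-> |[-> |(x & c & [-> | ->])]].
      - now exists pendant.
      - now exists hub.
      - now exists (elem x c).
      - now exists (coll x c). }
    apply mem_product_pair in H as [H _]. apply code_mem_vertices in H. eauto.
  - intros (v & V & ->).
    rewrite mem_product_pair, !code_mem_vertices.
    split; [auto using translate_valid|]. destruct v; simpl translate; eauto 8.
Qed.

Lemma mem_translation_pair g v b : g ∈ A ->
  pair (code v) b ∈ translation g <-> valid v /\ b = code (translate g v).
Proof.
  intros Hg. rewrite mem_translation by trivial. split.
  - now intros (w & V & [->%code_inj ->]%pair_inj).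
  - intros [V ->]. eauto.
Qed.

Lemma translation_inj g h :
  g ∈ A -> h ∈ A -> translation g = translation h -> g = h.
Proof.
  intros Hg Hh E. assert (V : valid (elem one A)) by now split.
  assert (H : pair (code (elem one A)) (code (translate g (elem one A)))
    ∈ translation h) by (rewrite <- E; now apply mem_translation_pair).
  apply mem_translation_pair in H as [_ H]; trivial.
  apply code_inj in H. injection H. now rewrite !mul_1_r.
Qed.

Lemma translation_function g :
  g ∈ A -> is_function (translation g) vertices vertices.
Proof.
  intros Hg. split.
  - intros e (v & V & ->)%mem_translation; trivial.
    exists (code v), (code (translate g v)).
    rewrite !code_mem_vertices, is_pair_iff. auto using translate_valid.
  - intros x (v & V & ->)%mem_vertices. exists (code (translate g v)). split.
    + now apply related_iff, mem_translation_pair.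
    + intros y H. apply related_iff, mem_translation_pair in H; trivial.
      now symmetry.
Qed.

Lemma related_translation g x y : g ∈ A ->
  related (translation g) x y <->
  exists v, valid v /\ x = code v /\ y = code (translate g v).
Proof.
  intros Hg. rewrite related_iff, mem_translation by trivial. split.
  - intros (v & V & [-> ->]%pair_inj). eauto.
  - intros (v & V & -> & ->). eauto.
Qed.

Lemma translation_automorphism g :
  g ∈ A -> is_automorphism (translation g) vertices edges.
Proof.
  intros Hg. split; [split; [|split]|].
  - now apply translation_function.
  - intros x x' y (v & V & -> & ->)%related_translation
      (v' & V' & -> & E%code_inj)%related_translation; trivial.
    f_equal. now apply (translate_inj A T one mul) with g.
  - intros y (v & V & ->)%mem_vertices.
    destruct (translate_surj A T one mul mul_in mul_1_l mul_assoc mul_inv g v)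
      as (u & U & <-); trivial.
    exists (code u). apply related_translation; eauto.
  - intros x y x' y' (u & U & -> & ->)%related_translation
      (v & V & -> & ->)%related_translation; trivial.
    rewrite !related_iff, !mem_edges. now apply translate_adj with one.
Qed.

(** The automorphism acts on vertices through their codes. Applied to codes it
    is an operation of the model, so the property proved by induction in
    [fiber_image] is definable. *)
Lemma automorphism_translation f :
  is_automorphism f vertices edges -> exists g, g ∈ A /\ f = translation g.
Proof.
  intros [(Hf & Hinj & Hsurj) Hadj].
  set (F := fun v => epsilon (inhabits pendant) (fun w => code w = app f (code v))).
  assert (HF : forall v, valid v -> valid (F v) /\ code (F v) = app f (code v)).
  { intros v V. assert (H : app f (code v) ∈ vertices)
      by (apply (app_in f vertices); trivial; now apply code_mem_vertices).
    assert (E : code (F v) = app f (code v)).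
    { unfold F. apply epsilon_spec. apply mem_vertices in H as (w & _ & E). eauto. }
    split; trivial. now rewrite <- code_mem_vertices, E. }
  assert (Hrel : forall v y, valid v -> related f (code v) y <-> y = code (F v)).
  { intros v y V. rewrite related_iff, (app_graph f _ _ _ _ Hf).
    rewrite code_mem_vertices, (proj2 (HF v V)). tauto. }
  destruct (automorphism_is_translation A T one mul one_in mul_1_l mul_1_r
    T_trans T_A T_cofinal F) as (g & Hg & HFg).
  - intros v V. now apply HF.
  - intros u v U V E. apply code_inj, (Hinj _ _ (code (F u))).
    + now apply Hrel.
    + rewrite E. now apply Hrel.
  - intros w W. destruct (Hsurj (code w)) as [x Hx]; [now apply code_mem_vertices|].
    assert (Hxv : x ∈ vertices)
      by (apply related_iff, (app_graph f _ _ _ _ Hf) in Hx; tauto).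
    apply mem_vertices in Hxv as (v & V & ->). exists v. split; trivial.
    apply Hrel, code_inj in Hx; auto.
  - intros u v U V. rewrite <- !mem_edges, <- !related_iff.
    apply Hadj; now apply Hrel.
  - intros x s Hx. exists (fun y =>
      app f (code (elem x y)) = code (elem s y) /\
      app f (code (coll x y)) = code (coll s y)).
    split.
    + simpl code. definable.
    + intros y Hy. unfold moves_fiber_point.
      rewrite <- !(fun v V => proj2 (HF v V)) by now split.
      split; intros [E E']; split; (congruence || now apply code_inj).
  - exists g. split; trivial. apply ext. intros e. rewrite mem_translation by trivial.
    split.
    + intros He. destruct (proj1 Hf e He)
        as (x & y & (v & V & ->)%mem_vertices & _ & ->%is_pair_iff).
      exists v. split; trivial. rewrite <- HFg by trivial. f_equal.
      now apply Hrel, related_iff.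
    + intros (v & V & ->). rewrite <- HFg by trivial. now apply related_iff, Hrel.
Qed.

Lemma composite_translation a b c : a ∈ A -> b ∈ A -> c ∈ A ->
  is_composite (translation c) (translation a) (translation b) <-> c = mul a b.
Proof.
  intros Ha Hb Hc. split.
  - intros H. assert (V : valid (elem one A)) by now split.
    destruct (proj1 (H (code (elem one A)) (code (translate c (elem one A)))))
      as (y & (v & _ & <-%code_inj & ->)%related_translation &
        (w & _ & <-%code_inj & E%code_inj)%related_translation); trivial.
    + apply related_translation; eauto.
    + injection E. now rewrite !mul_1_r.
  - intros -> x z. rewrite related_translation by trivial. split.
    + intros (v & V & -> & ->). exists (code (translate b v)).
      rewrite !related_translation by trivial. split; [eauto|].
      exists (translate b v). split; [now apply translate_valid|].
      split; trivial. f_equal. now apply (translate_mul A T).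
    + intros (y & (v & V & -> & ->)%related_translation &
        (w & _ & <-%code_inj & ->)%related_translation); trivial.
      exists v. split; [trivial|split; trivial]. f_equal. symmetry.
      now apply (translate_mul A T).
Qed.

Definition automorphisms : M := image A translation.

Lemma mem_automorphisms f :
  f ∈ automorphisms <-> exists g, g ∈ A /\ f = translation g.
Proof. apply mem_image, definable_translation. Qed.

Definition composition : M :=
  Union (image A (fun a => image A (fun b =>
    pair (pair (translation a) (translation b)) (translation (mul a b))))).

Lemma mem_composition z : z ∈ composition <-> exists a b, a ∈ A /\ b ∈ A /\
  z = pair (pair (translation a) (translation b)) (translation (mul a b)).
Proof.
  pose proof definable_translation as D.
  unfold composition. rewrite mem_Union. split.
  - intros (s & Hz & Hs). rewrite mem_image in Hs by definable.
    destruct Hs as (a & Ha & ->). rewrite mem_image in Hz by definable.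
    destruct Hz as (b & Hb & ->). eauto.
  - intros (a & b & Ha & Hb & ->). eexists.
    split; [|apply mem_image; [definable|]; exists a; split; [trivial|reflexivity]].
    apply mem_image; [definable|]. eauto.
Qed.

Lemma composition_val a b c : a ∈ A -> b ∈ A -> c ∈ A ->
  binop_val composition (translation a) (translation b) (translation c) <->
  c = mul a b.
Proof.
  intros Ha Hb Hc. rewrite binop_val_iff, mem_composition. split.
  - intros (a' & b' & Ha' & Hb' & [[E1 E2]%pair_inj E3]%pair_inj).
    apply translation_inj in E1, E2, E3; auto; congruence.
  - intros ->. exists a, b. auto.
Qed.

Lemma composition_binop : is_binop composition automorphisms.
Proof.
  exists (product automorphisms automorphisms).
  split; [apply is_prod_product|split].
  - intros p (a & b & Ha & Hb & ->)%mem_composition.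
    exists (pair (translation a) (translation b)), (translation (mul a b)).
    rewrite mem_product_pair, !mem_automorphisms, is_pair_iff.
    split; [split|split; [|reflexivity]]; eexists; split; [| reflexivity | |
      reflexivity | | reflexivity]; auto.
  - intros p (f & h & (a & Ha & ->)%mem_automorphisms &
      (b & Hb & ->)%mem_automorphisms & ->)%mem_product.
    exists (translation (mul a b)). split.
    + apply related_iff, mem_composition. exists a, b. auto.
    + intros y H. apply related_iff, mem_composition in H
        as (a' & b' & Ha' & Hb' & [[E1 E2]%pair_inj ->]%pair_inj).
      apply translation_inj in E1, E2; trivial. congruence.
Qed.

Lemma is_Aut_automorphisms :
  is_Aut (pair automorphisms composition) (pair vertices edges).
Proof.
  exists vertices, edges, automorphisms, composition.
  rewrite !is_pair_iff. do 2 (split; [reflexivity|]). split; [|split].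
  - intros f. rewrite mem_automorphisms. split.
    + intros (g & Hg & ->). now apply translation_automorphism.
    + apply automorphism_translation.
  - apply composition_binop.
  - intros f h k (a & Ha & ->)%mem_automorphisms (b & Hb & ->)%mem_automorphisms
      (c & Hc & ->)%mem_automorphisms.
    now rewrite composition_val, composite_translation.
Qed.

Definition regular_representation : M := image A (fun g => pair g (translation g)).

Lemma related_regular x y :
  related regular_representation x y <-> x ∈ A /\ y = translation x.
Proof.
  pose proof definable_translation as D.
  unfold regular_representation. rewrite related_iff, mem_image by definable. split.
  - now intros (g & Hg & [-> ->]%pair_inj).
  - intros [Hx ->]. eauto.
Qed.

Lemma regular_bijection : is_bijection regular_representation A automorphisms.
Proof.
  split; [|split].
  - apply image_function; [apply definable_translation|].
    intros x Hx. apply mem_automorphisms. eauto.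
  - intros x x' y [Hx ->]%related_regular [Hx' E]%related_regular.
    now apply translation_inj.
  - intros y (g & Hg & ->)%mem_automorphisms. exists g. now apply related_regular.
Qed.

End Encoding.

Theorem theorem1 (M : structure) (HZF : ZF M) (Gamma : M) :
  is_group Gamma ->
  exists G X : M, is_graph G /\ is_Aut X G /\ isomorphic_groups Gamma X.
Proof.
  intros (A & m & HG & (P & ->%is_prod_iff & Hm) & Hassoc & one & Hone &
    Hunit & Hinv).
  set (mul := fun x y => app m (pair x y)).
  assert (D : definable_op2 mul) by (unfold definable_op2, mul; definable).
  assert (Hval : forall x y z, binop_val m x y z <-> x ∈ A /\ y ∈ A /\ z = mul x y).
  { intros x y z. rewrite binop_val_iff, (app_graph m _ _ _ _ Hm), mem_product_pair.
    unfold mul. tauto. }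
  assert (mul_in : forall x y, x ∈ A -> y ∈ A -> mul x y ∈ A).
  { intros x y Hx Hy. apply (app_in m _ _ _ Hm). now apply mem_product_pair. }
  assert (mul_1_l : forall x, x ∈ A -> mul one x = x).
  { intros x Hx. symmetry. now apply Hval, Hunit. }
  assert (mul_1_r : forall x, x ∈ A -> mul x one = x).
  { intros x Hx. symmetry. now apply Hval, Hunit. }
  assert (mul_assoc : forall x y z, x ∈ A -> y ∈ A -> z ∈ A ->
     mul (mul x y) z = mul x (mul y z)).
  { intros x y z Hx Hy Hz.
    apply Hval, (Hassoc x y z (mul x y)); apply Hval; auto. }
  assert (mul_inv : forall x, x ∈ A ->
     exists y, y ∈ A /\ mul x y = one /\ mul y x = one).
  { intros x Hx. destruct (Hinv x Hx) as (y & Hy & H & H').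
    apply Hval in H, H'. exists y. intuition. }
  destruct (transitive_closure A) as (T & HT & HAT & Hcof).
  exists (pair (vertices A T) (edges A T mul)),
    (pair (automorphisms A T mul) (composition A T mul)).
  split; [|split].
  - exists (vertices A T), (edges A T mul). split; [now apply is_pair_iff|].
    now apply graph_axioms_edges.
  - now apply is_Aut_automorphisms with one.
  - exists A, m, (automorphisms A T mul), (composition A T mul).
    split; [exact HG|]. split; [now apply is_pair_iff|].
    exists (regular_representation A T mul).
    split; [now apply regular_bijection with one|].
    intros x y z x' y' z' (Hx & Hy & ->)%Hval [_ ->]%related_regular
      [_ ->]%related_regular [_ ->]%related_regular; trivial.
    apply composition_val with one; auto.
Qed.
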